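(* Let $n\ge 2$ and $\mathbf{y}=(y_1,y_2,\dots,y_n)\in\mathbb{N}^n$. If $\mathbf{y}$ is minimally invariant, i.e. $\mathsf{PA}^{\mathrm{inv}}_n(\mathbf{y})=\{(1,1,\dots,1)\}$, then $$y_1<\min(y_2,y_3,\dots,y_n)\quad\text{and}\quad y_2\neq\sum_{j\in[n]\setminus\{2\}}y_j.$$
   Context: $\mathbb{N}=\{1,2,3,\dots\}$ and $[n]=\{1,\dots,n\}$. Let $\mathbf{y}=(y_1,\dots,y_n)\in\mathbb{N}^n$ and $m=\sum_{i=1}^n y_i$. Consider a one-way street with $m$ parking spots numbered $1,\dots,m$ and $n$ cars entering in order $1,2,\dots,n$, where car $i$ has length $y_i$ and prefers spot $x_i\in[m]$. Car $i$ drives to spot $x_i$ and parks in $x_i,x_i+1,\dots,x_i+y_i-1$ if these spots exist and are all unoccupied; otherwise it parks in the next $y_i$ contiguous available spots, i.e. it occupies $s,s+1,\dots,s+y_i-1$ for the smallest $s\ge x_i$ such that $s+y_i-1\le m$ and all these spots are unoccupied; if no such $s$ exists, parking fails. The vector $\mathbf{x}=(x_1,\dots,x_n)\in[m]^n$ is a parking assortment for $\mathbf{y}$ if all cars can park; the set of these is $\mathsf{PA}_n(\mathbf{y})$. A parking assortment $\mathbf{x}$ is (permutation) invariant if every permutation of its entries is also in $\mathsf{PA}_n(\mathbf{y})$; $\mathsf{PA}^{\mathrm{inv}}_n(\mathbf{y})$ is the set of invariant parking assortments for $\mathbf{y}$. *)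

(* Defs.v *)
From mathcomp Require Import all_boot all_fingroup.
Set Implicit Arguments.
Unset Strict Implicit.
Unset Printing Implicit Defensive.

(* The spots of the street are the numbers 1, ..., m; [occ] lists the occupied
   ones. *)
Definition fits (m : nat) (occ : seq nat) (l s : nat) : bool :=
  all (fun t => (0 < t <= m) && (t \notin occ)) (iota s l).

(* The least s with p <= s <= m at which a car of length l fits, if any. *)
Definition parking_spot (m : nat) (occ : seq nat) (p l : nat) : option nat :=
  ohead [seq s <- iota p (m.+1 - p) | fits m occ l s].

(* Each car is a pair (preferred spot, length); cars enter in list order. *)
Fixpoint all_park (m : nat) (occ : seq nat) (cars : seq (nat * nat)) : bool :=
  if cars is (p, l) :: cars' then
    if parking_spot m occ p l is Some s then
      all_park m (iota s l ++ occ) cars'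
    else false
  else true.

Definition parking_assortment (n : nat) (y x : n.-tuple nat) : bool :=
  all (fun p => 0 < p <= sumn y) x && all_park (sumn y) [::] (zip x y).

(* The identity permutation makes x itself a parking assortment. *)
Definition invariant_assortment (n : nat) (y x : n.-tuple nat) : Prop :=
  forall s : 'S_n, parking_assortment y [tuple tnth x (s i) | i < n].

Definition minimally_invariant (n : nat) (y : n.-tuple nat) : Prop :=
  forall x : n.-tuple nat, invariant_assortment y x <-> x = [tuple of nseq n 1].

(* Main.v *)
(* Consider x = (v, 1, ..., 1) with v > 1.  Preferring spot 1, the cars form an
   initial block, so a rearrangement of x creates at most one gap, in front of
   the car preferring v; the remaining cars fill it greedily, and everybody
   parks as soon as the gap ends up exactly filled.
   If y_1 >= g := min (y_2, ..., y_n), take v = g + 1: a gap occurs only when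
   car 1 prefers v, and it is filled by the first later car of length g.
   If y_2 is the sum of the other lengths, take v = y_2 + 1: if car 1 prefers v
   the gap is filled by car 2, and if car 2 prefers v it is filled by all the
   cars 3, ..., n together.
   In both cases x is an invariant assortment other than (1, ..., 1). *)
Require Import Defs.
From mathcomp Require Import all_boot all_fingroup zify.

Lemma parking_spotE m occ p l s : p <= s <= m -> fits m occ l s ->
  (forall t, p <= t < s -> ~~ fits m occ l t) ->
  parking_spot m occ p l = Some s.
Proof.
move=> /andP[ps sm] fs nf; rewrite /parking_spot.
have -> : m.+1 - p = (s - p) + (m - s).+1 by lia.
rewrite iotaD filter_cat subnKC //= fs.
suff -> : [seq t <- iota p (s - p) | fits m occ l t] = [::] by [].
apply/eqP; rewrite -[_ == _]negbK -has_filter -all_predC.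
by apply/allP=> t; rewrite mem_iota subnKC // => /nf.
Qed.

Definition occupied_blocks (occ : seq nat) (a b e : nat) : Prop :=
  forall t, (t \in occ) = (0 < t <= a) || (b < t <= e).

(** Models cars that all prefer spot 1: each one that fits parks at the front of the gap and
    shortens it, every other one parks behind the last block. *)
Fixpoint gap_left (g : nat) (ls : seq nat) : nat :=
  if ls is l :: ls' then gap_left (if l <= g then g - l else g) ls' else g.

Lemma gap_left0 ls : gap_left 0 ls = 0.
Proof. by elim: ls => //= l ls; rewrite sub0n if_same. Qed.

Lemma gap_left_le g ls : g <= gap_left g ls + sumn ls.
Proof.
elim: ls g => [|l ls IH] g /=; first by rewrite addn0.
by have := IH (if l <= g then g - l else g); case: (leqP l g); lia.
Qed.

Lemma gap_left_sumn ls : gap_left (sumn ls) ls = 0.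
Proof. by elim: ls => //= l ls IH; rewrite leq_addr addKn. Qed.

(** Cars longer than [g] skip the gap, and the first car of length [g] fills it exactly. *)
Lemma gap_left_min g ls : g \in ls -> all (leq g) ls -> gap_left g ls = 0.
Proof.
elim: ls => //= l ls IH; rewrite inE => gls /andP[gl lsg].
case: (leqP l g) => [lg|ltgl].
  have -> : g - l = 0 by lia.
  exact: gap_left0.
by apply: IH => //; move: gls; rewrite ltn_eqF.
Qed.

(* If a < b = e, the second block is empty and nothing closes the gap on the
   right. *)
Lemma all_park_ones m occ a b e ls :
  occupied_blocks occ a b e -> a <= b <= e -> (a == b) || (b < e) ->
  all (leq 1) ls ->
  a + (e - b) + sumn ls <= m -> gap_left (b - a) ls = 0 ->
  all_park m occ (zip (nseq (size ls) 1) ls).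
Proof.
elim: ls occ a b e => //= l ls IH occ a b e occE abe ab_e /andP[l0 ls0] le_m.
case: leqP => [lg|gl] left0.
- rewrite (@parking_spotE _ _ _ _ a.+1).
  + apply: (IH _ (a + l) b e) => //; try lia; last by rewrite subnDA.
    by move=> t; rewrite mem_cat mem_iota occE; lia.
  + by lia.
  + by apply/allP=> t; rewrite mem_iota occE; lia.
  + move=> t ta; apply/negP=> /allP/(_ t); rewrite mem_iota occE; lia.
(* Since the gap finally closes, it is no longer than the later cars together, so the street has
   room for this car behind spot [e]. *)
have := gap_left_le (b - a) ls; rewrite left0 => gls.
rewrite (@parking_spotE _ _ _ _ e.+1).
+ apply: (IH _ a b (e + l)) => //; try lia.
  by move=> t; rewrite mem_cat mem_iota occE; lia.
+ by lia.
+ by apply/allP=> t; rewrite mem_iota occE; lia.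
move=> t te; apply/negP=> /allP fit.
(* A car longer than the gap that starts inside it would cover [b.+1], which is occupied whenever
   the gap is nonempty. *)
have := fit t; have := fit b.+1.
by rewrite !mem_iota !occE; lia.
Qed.

(* The truncated subtraction makes the gap empty when [v] lies in the block of
   already parked cars or just behind it. *)
Lemma all_park_one_late m occ a v i ls :
  occupied_blocks occ a a a -> all (leq 1) ls -> i < size ls ->
  0 < v -> v <= m -> a + sumn ls <= m ->
  gap_left (v.-1 - a - sumn (take i ls)) (drop i.+1 ls) = 0 ->
  all_park m occ (zip (nseq i 1 ++ v :: nseq (size ls - i.+1) 1) ls).
Proof.
elim: i occ a ls => [|i IH] occ a [|l ls] //= occE /andP[l0 ls0] i_lt v0 vm le_m.
  rewrite drop0 subn0 subSS subn0 => left0.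
  have := gap_left_le (v.-1 - a) ls; rewrite left0 => gls.
  rewrite (@parking_spotE _ _ _ _ (maxn v.-1 a).+1).
  - apply: (all_park_ones _ _ a (maxn v.-1 a) (maxn v.-1 a + l)) => //; try lia.
      by move=> t; rewrite mem_cat mem_iota occE; lia.
    by rewrite -left0; congr gap_left; lia.
  - by lia.
  - by apply/allP=> t; rewrite mem_iota occE; lia.
  - move=> t ta; apply/negP=> /allP/(_ t); rewrite mem_iota occE; lia.
move=> left0.
rewrite (@parking_spotE _ _ _ _ a.+1).
- apply: (IH _ (a + l)) => //; try lia.
    by move=> t; rewrite mem_cat mem_iota occE; lia.
  by rewrite -left0; congr gap_left; lia.
- by lia.
- by apply/allP=> t; rewrite mem_iota occE; lia.
- move=> t ta; apply/negP=> /allP/(_ t); rewrite mem_iota occE; lia.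
Qed.

(** Here [i] counts the cars that enter before the one preferring [v]; a permutation of
    [(v, 1, ..., 1)] matters only through [i]. *)
Lemma minimally_invariant_one_late n (y : n.+1.-tuple nat) v :
  minimally_invariant y -> all (leq 1) y -> 0 < v <= sumn y ->
  (forall i, i <= n ->
     gap_left (v.-1 - sumn (take i y)) (drop i.+1 y) = 0) ->
  v = 1.
Proof.
move=> ymin y0 /andP[v0 vm] left0.
pose x := [tuple if i == ord0 then v else 1 | i < n.+1].
suff /ymin : invariant_assortment y x.
  by move/(congr1 (fun t : n.+1.-tuple nat => tnth t ord0));
     rewrite tnth_mktuple eqxx => ->; rewrite (tnth_nth 0).
move=> s; pose j := (s^-1%g) ord0.
have xsE : [tuple tnth x (s i) | i < n.+1] =
           nseq j 1 ++ v :: nseq (size y - j.+1) 1 :> seq nat.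
  apply: (@eq_from_nth _ 0); rewrite size_tuple.
    by rewrite size_cat /= !size_nseq size_tuple; have := ltn_ord j; lia.
  move=> k k_lt; rewrite -[k]/(val (Ordinal k_lt)) -tnth_nth !tnth_mktuple.
  rewrite (canF_eq (permK s)) -/j -val_eqE /= nth_cat size_nseq.
  case: ltngtP => kj; first by rewrite nth_nseq kj.
    rewrite -[k - j]prednK ?subn_gt0 //= nth_nseq size_tuple.
    by case: ifP => //; lia.
  by rewrite kj subnn.
rewrite /parking_assortment xsE; apply/andP; split.
  rewrite all_cat /= v0 vm /= !all_nseq /=.
  by rewrite (leq_trans v0 vm) !orbT.
apply: (all_park_one_late _ _ 0) => //; first by case.
- by rewrite size_tuple ltn_ord.
- by rewrite subn0; apply: left0; rewrite -ltnS ltn_ord.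
Qed.

Theorem theorem1 (n : nat) (y : n.-tuple nat) (hn : 2 <= n)
    (hy : forall i : 'I_n, 0 < tnth y i) (hmin : minimally_invariant y) :
  nth 0 y 0 < \big[minn/nth 0 y 1]_(1 <= j < n) nth 0 y j
  /\ nth 0 y 1 <> \sum_(0 <= j < n | j != 1) nth 0 y j.
Proof.
have y_gt0 : all (leq 1) y by apply/all_tnthP.
case: n => [|[|n]] // in y hn hy hmin y_gt0 *.
have late := minimally_invariant_one_late _ _ _ hmin y_gt0.
case yE: (val y) => [|y0 [|y1 r]]; try by have := size_tuple y; rewrite yE.
have size_r : size r = n by have := size_tuple y; rewrite yE => -[].
move: y_gt0 late; rewrite yE /= => /and3P[y0_gt0 y1_gt0 _] late.
split.
  have lt_all l : l \in y1 :: r -> y0 < l.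
    move=> ll; rewrite ltnNge; apply/negP=> l_le.
    have [|g gP gmin] := @ex_minnP (mem (y1 :: r)); first by exists l.
    have g_le : g <= y0 by apply: leq_trans l_le; apply: gmin.
    have g_gt0 : 0 < g.
      have /tnthP[i ->] : g \in y by rewrite memtE yE inE; apply/orP; right.
      exact: hy.
    have g_sum : g <= y1 + sumn r.
      have -> : y1 + sumn r = sumn (y1 :: r) by [].
      by rewrite (perm_sumn (perm_to_rem gP)) leq_addr.
    suff : g.+1 = 1 by lia.
    apply: late; first lia.
    case=> [|i] _ /=.
      rewrite subn0; apply: gap_left_min gP _.
      by apply/allP=> k /gmin.
    (* Car 1 already covers spots 1 to [g], so a later car preferring [g.+1] leaves no gap. *)
    by have -> : g - (y0 + sumn (take i (y1 :: r))) = 0; [lia | exact: gap_left0].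
  (* The initial value of the minimum is [y1], itself one of the bounded lengths. *)
  rewrite big_nat; elim/big_ind: _ => [|a b|[|j] /andP[] //= _ j_lt].
  - by apply: lt_all; rewrite inE eqxx.
  - by rewrite leq_min => -> ->.
  - by apply: lt_all; rewrite mem_nth /= ?size_r.
have -> : \sum_(0 <= j < n.+2 | j != 1) nth 0 (y0 :: y1 :: r) j = y0 + sumn r.
  rewrite big_ltn_cond //= big_ltn_cond //= big_add1 big_add1 /=.
  by rewrite sumnE [in RHS](big_nth 0) size_r.
move=> /= y1E; suff : y1.+1 = 1 by lia.
apply: late; first lia.
case=> [|[|i]] _ /=; rewrite ?drop0 ?take0 /=.
- by rewrite subn0 leqnn subnn gap_left0.
- by rewrite addn0 y1E addKn gap_left_sumn.
- have -> : y1 - (y0 + (y1 + sumn (take i r))) = 0 by lia.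
  exact: gap_left0.
Qed.
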